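(* Let $p$ be a prime number and let $0\ne f(t)\in\mathbb{C}_p[t^{\pm1}]$ be a Laurent polynomial, possibly with roots on $|z|_p=1$. Write $f(t)=\sum_{0\le i\le l}a_it^{d-i}=a_0t^{d-l}\prod_{1\le i\le l}(t-\alpha_i)$ with $d\in\mathbb{Z}$, $l\in\mathbb{Z}_{\ge0}$, $a_i,\alpha_i\in\mathbb{C}_p$ and $a_0a_l\ne0$. If $M_p(f(t))$ is defined by $$\log M_p(f(t))=\lim_{n\to\infty}\frac1n\sum_{\zeta^n=1,\ f(\zeta)\neq0}\log|f(\zeta)|_p,$$ where $n$ runs over all positive integers, $\zeta$ runs over the $n$-th roots of unity in $\mathbb{C}_p$ with $f(\zeta)\ne0$, and the limit is taken with respect to the Euclidean topology, then (the limit exists and) $$\log M_p(f(t))=\log|a_l|_p-\sum_{0<|\alpha_i|_p<1}\log|\alpha_i|_p=\log|a_0|_p+\sum_{|\alpha_i|_p>1}\log|\alpha_i|_p .$$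
   Context: $\mathbb{C}_p$ is the $p$-adic completion of an algebraic closure of $\mathbb{Q}_p$, with $p$-adic absolute value $|\cdot|_p$ normalized by $|p|_p=p^{-1}$; $\log$ is the real logarithm. *)

(* Defs.v *)
From HB Require Import structures.
From mathcomp Require Import all_boot all_order all_algebra finmap.
From mathcomp Require Import all_classical all_reals all_analysis.

Set Implicit Arguments.
Unset Strict Implicit.
Unset Printing Implicit Defensive.

Import Order.TTheory GRing.Theory Num.Theory.
Import numFieldNormedType.Exports.

Local Open Scope classical_set_scope.
Local Open Scope ring_scope.

Section ValuedFields.
Variable R : realType.

Record nonarch_abs (K : fieldType) (abs : K -> R) : Prop := NonarchAbs {
  nonarch_abs_ge0 : forall x, 0 <= abs x;
  nonarch_abs_eq0 : forall x, abs x = 0 <-> x = 0;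
  nonarch_absM : forall x y, abs (x * y) = abs x * abs y;
  nonarch_absD : forall x y, abs (x + y) <= Num.max (abs x) (abs y) }.

Definition abs_cvg (K : fieldType) (abs : K -> R) (u : nat -> K) (a : K) :=
  forall e : R, 0 < e ->
    exists N : nat, forall n : nat, (N <= n)%N -> abs (u n - a) < e.

Definition abs_cauchy (K : fieldType) (abs : K -> R) (u : nat -> K) :=
  forall e : R, 0 < e ->
    exists N : nat, forall m n : nat, (N <= m)%N -> (N <= n)%N ->
      abs (u m - u n) < e.

Definition abs_complete (K : fieldType) (abs : K -> R) :=
  forall u : nat -> K, abs_cauchy abs u -> exists a : K, abs_cvg abs u a.

Record is_completion (F K : fieldType) (absF : F -> R) (absK : K -> R)
    (iota : {rmorphism F -> K}) : Prop := IsCompletion {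
  completion_abs : nonarch_abs absK;
  completion_isometry : forall x, absK (iota x) = absF x;
  completion_dense : forall (y : K) (e : R), 0 < e ->
    exists x : F, absK (y - iota x) < e;
  completion_complete : abs_complete absK }.

Definition is_algebraic_closure (F : fieldType) (L : closedFieldType)
    (iota : {rmorphism F -> L}) : Prop :=
  forall x : L, algebraicOver iota x.

Definition padic_abs (p : nat) (x : rat) : R :=
  if x == 0 then 0
  else p%:R ^+ logn p `|denq x|%N / p%:R ^+ logn p `|numq x|%N.

(* C_p is specified up to isometric isomorphism: [K], with absolute value
   [abs], is a completion of an algebraic closure [L] of a completion [Qp] of
   the rationals for the p-adic absolute value. *)
Definition is_Cp (p : nat) (K : fieldType) (abs : K -> R) : Prop :=
  exists (Qp : fieldType) (absQp : Qp -> R) (i : {rmorphism rat -> Qp})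
         (L : closedFieldType) (absL : L -> R) (j : {rmorphism Qp -> L})
         (k : {rmorphism L -> K}),
    [/\ is_completion (padic_abs p) absQp i,
        is_algebraic_closure j,
        nonarch_abs absL /\ (forall x, absL (j x) = absQp x)
      & is_completion absL abs k].

End ValuedFields.

(* A Laurent polynomial is its finitely supported family of coefficients. *)
Definition laurent (K : fieldType) := {fsfun int -> K with 0}.

Definition laurent_eval (K : fieldType) (f : laurent K) (z : K) : K :=
  \sum_(k <- finsupp f) f k * z ^ k.

(* [eq_laurent_shift f m q]: f(t) = t^m q(t) in K[t, t^-1]. *)
Definition eq_laurent_shift (K : fieldType) (f : laurent K) (m : int)
    (q : {poly K}) : Prop :=
  forall k : int, f k = if (k - m)%R is Posz n then q`_n else 0.

Section MahlerMeasure.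
Variables (R : realType) (K : fieldType) (abs : K -> R).

(* The index set of the sum is finite for every n > 0; the value at n = 0 is
   irrelevant to the limit. *)
Definition log_mahler_seq (f : laurent K) (n : nat) : R :=
  n%:R^-1 * \sum_(z \in [set z : K | z ^+ n = 1 /\ laurent_eval f z != 0])
              ln (abs (laurent_eval f z)).

Definition mahler (f : laurent K) : R :=
  expR (lim (log_mahler_seq f n @[n --> \oo])).

End MahlerMeasure.

(* Main.v *)
(* Since log |f(z)| is additive over the factors of f, everything reduces to the
   mean of log |z - x| over the n-th roots of unity z != x.  For x^n != 1 the sum
   is log |x^n - 1|, and for x^n = 1 it is log |n x^(n-1)|, the derivative of
   X^n - 1 at x.  When |x| != 1 this is n log max(1, |x|) exactly; when |x| = 1 it
   lies between log (C / n) and 0 for some C > 0, because |b^k - 1| >= |b - 1| / k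
   as soon as |b - 1| < 1/p.  The zeros of f excluded from the sum contribute
   O(1) to it. *)

Require Import Defs.
From HB Require Import structures.
From mathcomp Require Import all_boot all_order all_algebra finmap.
From mathcomp Require Import separable cyclotomic.
From mathcomp Require Import all_classical all_reals all_analysis.

Set Implicit Arguments.
Unset Strict Implicit.
Unset Printing Implicit Defensive.

Import Order.TTheory GRing.Theory Num.Theory.
Import numFieldNormedType.Exports.

Local Open Scope classical_set_scope.
Local Open Scope ring_scope.

(** * Ultrametric estimates for general absolute values *)

Section NonarchAbs.
Variables (R : realType) (K : fieldType) (abs : K -> R).
Hypothesis absP : nonarch_abs abs.

Lemma abs0 : abs 0 = 0. Proof. exact/(nonarch_abs_eq0 absP). Qed.

Lemma abs_gt0 x : (0 < abs x) = (x != 0).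
Proof.
rewrite lt_def (nonarch_abs_ge0 absP) andbT; congr (~~ _).
by apply/eqP/eqP => /(nonarch_abs_eq0 absP).
Qed.

Lemma abs1 : abs 1 = 1.
Proof.
have h : abs 1 != 0 by rewrite gt_eqF // abs_gt0 oner_neq0.
by apply: (mulfI h); rewrite -(nonarch_absM absP) !mulr1.
Qed.

Lemma absX x n : abs (x ^+ n) = abs x ^+ n.
Proof.
by elim: n => [|n IHn]; rewrite ?expr0 ?abs1 // !exprS (nonarch_absM absP) IHn.
Qed.

Lemma absN x : abs (- x) = abs x.
Proof.
have : abs (-1) = 1.
  apply/eqP; rewrite -(@eqrXn2 _ 2) ?ler01 ?(nonarch_abs_ge0 absP) //.
  by rewrite -absX sqrrN !expr1n abs1.
by move=> absN1; rewrite -mulN1r (nonarch_absM absP) absN1 mul1r.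
Qed.

Lemma abs_subC x y : abs (x - y) = abs (y - x).
Proof. by rewrite -absN opprB. Qed.

Lemma abs_prod (I : Type) (r : seq I) (P : pred I) (F : I -> K) :
  abs (\prod_(i <- r | P i) F i) = \prod_(i <- r | P i) abs (F i).
Proof. exact: (big_morph _ (nonarch_absM absP) abs1). Qed.

Lemma abs_sum_le (I : Type) (r : seq I) (P : pred I) (F : I -> K) (c : R) :
  0 <= c -> (forall i, P i -> abs (F i) <= c) ->
  abs (\sum_(i <- r | P i) F i) <= c.
Proof.
move=> c0 Fc; apply: (big_ind (fun x => abs x <= c)) => //.
  by rewrite abs0.
by move=> x y xc yc; rewrite (le_trans (nonarch_absD absP _ _)) // ge_max xc.
Qed.

Lemma abs_sub_le x y (c : R) : abs x <= c -> abs y <= c -> abs (x - y) <= c.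
Proof.
by move=> xc yc; rewrite (le_trans (nonarch_absD absP _ _)) // ge_max absN xc.
Qed.

Lemma abs_sub_lt x y (c : R) : abs x < c -> abs y < c -> abs (x - y) < c.
Proof.
by move=> xc yc; rewrite (le_lt_trans (nonarch_absD absP _ _)) // gt_max absN xc.
Qed.

(** If [abs x] were smaller than [abs y], then [y = x - (x - y)] would be a difference of two
    elements of absolute value below [abs y]. *)
Lemma abs_eq_of_close x y : abs (x - y) < abs y -> abs x = abs y.
Proof.
move=> xy; apply/eqP; rewrite eq_le -{1}(subrK y x).
rewrite (le_trans (nonarch_absD absP _ _)) ?ge_max ?lexx ?andbT ?(ltW xy) //=.
rewrite leNgt; apply/negP => lt_xy.
have := abs_sub_lt lt_xy xy.
by rewrite opprB addrC subrK ltxx.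
Qed.

Lemma abs_nat_le1 n : abs n%:R <= 1.
Proof.
elim: n => [|n IHn]; first by rewrite abs0.
by rewrite -natr1 (le_trans (nonarch_absD absP _ _)) // ge_max IHn abs1 /=.
Qed.

Lemma abs_eq1_of_close (b : K) : abs (b - 1) < 1 -> abs b = 1.
Proof. by rewrite -{1}abs1 => /abs_eq_of_close ->; rewrite abs1. Qed.

(** The cofactor of [b - 1] in [b ^+ n - 1] is a sum of powers of [b], so its absolute value is at
    most 1. *)
Lemma abs_expr_sub1_le (b : K) n : abs b <= 1 -> abs (b ^+ n - 1) <= abs (b - 1).
Proof.
move=> b1; rewrite subrX1 (nonarch_absM absP).
rewrite ler_piMr ?(nonarch_abs_ge0 absP) //.
by apply: abs_sum_le => // i _; rewrite absX exprn_ile1 ?(nonarch_abs_ge0 absP).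
Qed.

(* Each of the [k] terms of [(b^k - 1) / (b - 1) = \sum_(i < k) b^i] is within
   [abs (b - 1)] of 1. *)
Lemma abs_expr_sub1 (b : K) k :
  abs (b - 1) < abs k%:R -> abs (b ^+ k - 1) = abs k%:R * abs (b - 1).
Proof.
move=> bk; have b1 : abs b = 1.
  by apply: abs_eq1_of_close; rewrite (lt_le_trans bk) ?abs_nat_le1.
rewrite subrX1 (nonarch_absM absP) mulrC; congr (_ * _).
apply: abs_eq_of_close; apply: le_lt_trans bk.
have -> : k%:R = \sum_(i < k) 1 :> K by rewrite sumr_const card_ord.
rewrite -sumrB; apply: abs_sum_le => [|i _]; first exact: nonarch_abs_ge0.
by apply: abs_expr_sub1_le; rewrite b1.
Qed.

(** * How close powers can come to 1 when |p| = 1/p *)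

Section Padic.
Variable p : nat.
Hypothesis p_prime : prime p.
Hypothesis abs_p : abs p%:R = p%:R^-1.
Hypothesis abs_coprime : forall k, ~~ (p %| k)%N -> abs k%:R = 1.

Let p_gt0 : 0 < p%:R^-1 :> R.
Proof. by rewrite invr_gt0 ltr0n prime_gt0. Qed.

Let p_lt1 : p%:R^-1 < 1 :> R.
Proof. by rewrite invf_lt1 ?ltr0n ?prime_gt0 // ltr1n prime_gt1. Qed.

(** Each factor p of [k] contributes exactly 1/p, and the cofactor prime to p has absolute value 1;
    the induction strips one factor p at a time. *)
Lemma abs_nat_ge k : (0 < k)%N -> k%:R^-1 <= abs k%:R.
Proof.
elim/ltn_ind: k => k IHk k_gt0.
have [/dvdnP[m Dk]|pk] := boolP (p %| k)%N; last first.
  by rewrite abs_coprime // invf_le1 ?ltr0n // ler1n.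
have m_gt0 : (0 < m)%N by move: k_gt0; rewrite Dk muln_gt0 => /andP[].
rewrite Dk !natrM (nonarch_absM absP) invfM abs_p ler_wpM2r ?(ltW p_gt0) //.
by apply: IHk; rewrite // Dk ltn_Pmulr ?prime_gt1.
Qed.

(** Induction on [k], stripping factors p. An exponent prime to p keeps the distance to 1. For
    [k = m * p], the element [b ^+ m] is still within 1/p = |p| of 1, so raising it to the power p
    divides its distance to 1 by exactly p. *)
Lemma abs_expr_sub1_ge (b : K) k : (0 < k)%N -> abs (b - 1) < p%:R^-1 ->
  k%:R^-1 * abs (b - 1) <= abs (b ^+ k - 1).
Proof.
elim/ltn_ind: k => k IHk k_gt0 bp.
have [/dvdnP[m Dk]|pk] := boolP (p %| k)%N; last first.
  rewrite abs_expr_sub1 abs_coprime // ?(lt_trans bp) // mul1r.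
  by rewrite ler_piMl ?(nonarch_abs_ge0 absP) // invf_le1 ?ltr0n // ler1n.
have m_gt0 : (0 < m)%N by move: k_gt0; rewrite Dk muln_gt0 => /andP[].
have b1 : abs b = 1 by apply: abs_eq1_of_close; rewrite (lt_trans bp).
have bm : abs (b ^+ m - 1) < p%:R^-1.
  by rewrite (le_lt_trans _ bp) // abs_expr_sub1_le // b1.
rewrite Dk exprM (abs_expr_sub1 (b := b ^+ m)) abs_p //.
rewrite natrM invfM mulrAC mulrC ler_wpM2l ?(ltW p_gt0) //.
by apply: IHk; rewrite // Dk ltn_Pmulr ?prime_gt1.
Qed.

(* The exponents [n] with [abs (x ^+ n - 1) < 1/p] are the multiples of the
   least positive one, if any. *)
Lemma abs_expr_sub1_lower_bound (x : K) : abs x = 1 ->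
  exists2 C : R, 0 < C & forall n, (0 < n)%N -> x ^+ n != 1 ->
    n%:R^-1 * C <= abs (x ^+ n - 1).
Proof.
move=> x1.
have inv_le1 (n : nat) : (0 < n)%N -> n%:R^-1 <= 1 :> R.
  by move=> n_gt0; rewrite invf_le1 ?ltr0n // ler1n.
pose close n := (0 < n)%N && (abs (x ^+ n - 1) < p%:R^-1).
have far n : (0 < n)%N -> ~~ close n -> n%:R^-1 * p%:R^-1 <= abs (x ^+ n - 1).
  move=> n_gt0; rewrite /close n_gt0 -leNgt; apply: le_trans.
  by rewrite ler_piMl ?(ltW p_gt0) ?inv_le1.
have [close_ex|/forallNP none] := pselect (exists n, close n); last first.
  by exists p%:R^-1 => // n n_gt0 _; apply: far => //; apply/negP/none.
case: (ex_minnP close_ex) => m /andP[m_gt0 xm] m_min.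
have absxX n : abs (x ^+ n) = 1 by rewrite absX x1 expr1n.
(* A nonzero remainder of [n] modulo [m] would be a close exponent smaller than [m]:
   [x ^+ (n %% m) - 1] is a difference of two elements of absolute value below 1/p. *)
have dvd_close n : close n -> (m %| n)%N.
  case/andP=> n_gt0 xn; rewrite /dvdn eqn0Ngt; apply/negP => r_gt0.
  suff /m_min : close (n %% m)%N by rewrite leqNgt ltn_pmod.
  rewrite /close r_gt0 /=.
  have -> : x ^+ (n %% m) - 1
      = x ^+ n - 1 - x ^+ (n %% m) * ((x ^+ m) ^+ (n %/ m) - 1).
    rewrite {2}(divn_eq n m) addnC exprD mulnC exprM mulrBr mulr1 opprB.
    by rewrite [RHS]addrC addrA subrK.
  apply: abs_sub_lt => //.
  rewrite (nonarch_absM absP) absxX mul1r (le_lt_trans _ xm) //.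
  by rewrite abs_expr_sub1_le ?absxX.
(* Exponents that are not close give at least 1/p, and [n = m * k] gives at least
   [abs (x ^+ m - 1) / k]. If [x ^+ m = 1], every close exponent has [x ^+ n = 1] and is excluded,
   so 1/p alone serves. *)
exists (if x ^+ m == 1 then p%:R^-1 else Num.min p%:R^-1 (abs (x ^+ m - 1))).
  by case: ifPn => // xm1; rewrite lt_min p_gt0 abs_gt0 subr_eq0.
move=> n n_gt0 xn1.
have n_inv_ge0 : 0 <= n%:R^-1 :> R by rewrite invr_ge0.
have [cn|ncn] := boolP (close n); last first.
  apply: le_trans (far n n_gt0 ncn); rewrite ler_wpM2l //.
  by case: ifP => // _; rewrite ge_min lexx.
have /dvdnP[k Dn] := dvd_close n cn.
have k_gt0 : (0 < k)%N by move: n_gt0; rewrite Dn muln_gt0 => /andP[].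
move: xn1; rewrite Dn mulnC exprM; case: (eqVneq (x ^+ m) 1) => [->|_ _].
  by rewrite expr1n eqxx.
apply: le_trans (abs_expr_sub1_ge k_gt0 xm).
apply: ler_pM; rewrite ?invr_ge0 //.
- by rewrite le_min (ltW p_gt0) (nonarch_abs_ge0 absP).
- by rewrite lef_pV2 ?posrE ?ltr0n ?muln_gt0 ?m_gt0 // ler_nat leq_pmull.
- by rewrite ge_min lexx orbT.
Qed.

End Padic.

End NonarchAbs.

(** * Natural numbers and roots of unity in C_p *)

Lemma padic_abs_nat (R : realType) p n : (0 < n)%N ->
  padic_abs R p n%:R = (p%:R ^+ logn p n)^-1.
Proof.
move=> n_gt0; have -> : n%:R = n%:Z%:~R :> rat by rewrite pmulrn.
by rewrite /padic_abs intr_eq0 gt_eqF // numq_int denq_int logn1 expr0 mul1r.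
Qed.

Section Cp.
Variables (R : realType) (p : nat) (K : fieldType) (abs : K -> R).
Hypothesis p_prime : prime p.
Hypothesis K_Cp : is_Cp p abs.

Lemma Cp_nonarch_abs : nonarch_abs abs.
Proof. by case: K_Cp => [? [? [? [? [? [? [? [_ _ _ []]]]]]]]]. Qed.

Lemma Cp_abs_nat n : abs n%:R = padic_abs R p n%:R.
Proof.
case: K_Cp => Qp [aQ [i [L [aL [j [k [[_ i_iso _ _] _ [_ j_iso] [_ k_iso _ _]]]]]]]].
by rewrite -i_iso -j_iso -k_iso !rmorph_nat.
Qed.

Lemma Cp_abs_prime : abs p%:R = p%:R^-1.
Proof. by rewrite Cp_abs_nat padic_abs_nat ?prime_gt0 // logn_prime // eqxx expr1. Qed.

Lemma Cp_abs_coprime n : ~~ (p %| n)%N -> abs n%:R = 1.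
Proof. 
case: n => [|n] pn; first by rewrite dvdn0 in pn.
by rewrite Cp_abs_nat padic_abs_nat // lognE (negPf pn) !andbF expr0 invr1. Qed.

Lemma Cp_nat_neq0 n : (0 < n)%N -> n%:R != 0 :> K.
Proof.
move=> n_gt0; rewrite -(abs_gt0 Cp_nonarch_abs).
apply: lt_le_trans (abs_nat_ge Cp_nonarch_abs p_prime Cp_abs_prime
  Cp_abs_coprime n_gt0).
by rewrite invr_gt0 ltr0n.
Qed.

(** The splitting over the closed field [L] is carried to [K] by the embedding [k]; the roots are
    distinct because [n] is nonzero in [K], which makes ['X^n - 1] separable. *)
Lemma Cp_unity_roots n : (0 < n)%N ->
  exists2 rs : seq K, uniq rs & 'X^n - 1 = \prod_(z <- rs) ('X - z%:P).
Proof.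
move=> n_gt0; case: K_Cp => Qp [aQ [i [L [aL [j [k _]]]]]].
have [rs] := closed_field_poly_normal ('X^n - 1 : {poly L}).
rewrite -[X in lead_coef (_ - X)]polyC1 lead_coefXnsubC // scale1r => Drs.
have DK : 'X^n - 1 = \prod_(z <- [seq k z | z <- rs]) ('X - z%:P).
  rewrite big_map -(map_prod_XsubC k) -Drs.
  by rewrite rmorphB rmorph1 /= map_polyXn.
exists [seq k z | z <- rs] => //.
by rewrite -separable_prod_XsubC -DK separable_Xn_sub_1 // Cp_nat_neq0.
Qed.

End Cp.

(** * Real sums, logarithms and limits *)

Lemma ln_prod (R : realType) (I : eqType) (r : seq I) (F : I -> R) :
  (forall i, i \in r -> 0 < F i) ->
  ln (\prod_(i <- r) F i) = \sum_(i <- r) ln (F i).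
Proof.
elim: r => [|i r IHr] F_gt0; first by rewrite !big_nil ln1.
have Fr j : j \in r -> 0 < F j by move=> jr; rewrite F_gt0 // inE jr orbT.
rewrite !big_cons lnM ?IHr // posrE; first by rewrite F_gt0 ?mem_head.
by rewrite big_seq; apply: prodr_gt0.
Qed.

(** Serves to bound the contribution of the excluded zeros uniformly in n: [s] will be the zeros of
    f among the n-th roots of unity, [t] the list of all [alpha i], where repetitions may occur. *)
Lemma ler_sum_subset (R : numDomainType) (I : eqType) (s t : seq I) (F : I -> R) :
  (forall i, 0 <= F i) -> uniq s -> {subset s <= t} ->
  \sum_(i <- s) F i <= \sum_(i <- t) F i.
Proof.
move=> F_ge0; elim: s t => [|x s IHs] t /=.
  by move=> _ _; rewrite big_nil sumr_ge0.
case/andP=> xs s_uniq st; have xt : x \in t by rewrite st ?mem_head.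
rewrite (perm_big _ (perm_to_rem xt)) !big_cons lerD2l IHs // => y ys.
have : y \in t by rewrite st // inE ys orbT.
by rewrite (perm_mem (perm_to_rem xt)) inE => /predU1P[yx|//]; rewrite -yx ys in xs.
Qed.

Lemma invn_cvg0 (R : realType) : (n%:R^-1 : R) @[n --> \oo] --> 0.
Proof. by rewrite -cvg_shiftS; exact: cvg_harmonic. Qed.

(** With s the square root of n, ln n = 2 ln s <= 2 s, so the quotient lies between 0 and 2 / s. *)
Lemma invn_ln_cvg0 (R : realType) : (n%:R^-1 * ln n%:R : R) @[n --> \oo] --> 0.
Proof.
have sqrt_cvg0 : (2 * Num.sqrt n%:R^-1 : R) @[n --> \oo] --> 0.
  have -> : 0 = 2 * Num.sqrt 0 :> R by rewrite sqrtr0 mulr0.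
  apply: cvgM; first exact: cvg_cst.
  exact: (continuous_cvg _ (@sqrt_continuous R 0) (@invn_cvg0 R)).
apply: squeeze_cvgr (cvg_cst 0) sqrt_cvg0.
near=> n; have n_gt0 : 0 < n%:R :> R by rewrite ltr0n; near: n; exact: nbhs_infty_gt.
rewrite mulr_ge0 ?invr_ge0 ?(ltW n_gt0) ?ln_ge0 ?ler1n -?(ltr0n R) //=.
pose s : R := Num.sqrt n%:R; have s_gt0 : 0 < s by rewrite sqrtr_gt0.
have Dn : n%:R = s ^+ 2 by rewrite sqr_sqrtr // ltW.
rewrite sqrtrV ?(ltW n_gt0) // -/s Dn lnXn // -[ln s *+ 2]mulr_natl mulrCA ler_pM2l //.
rewrite expr2 invfM -mulrA ler_piMr ?invr_ge0 ?(ltW s_gt0) //.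
by rewrite mulrC ler_pdivrMr // mul1r ltW // ln_sublinear.
Unshelve. all: by end_near. Qed.

(** * Distances from a point to the n-th roots of unity *)

Section UnityRoots.
Variables (R : realType) (K : fieldType) (abs : K -> R).
Hypothesis absP : nonarch_abs abs.

(* By the junk value [ln 0 = 0], a root of unity [x] contributes no term [z = x];
   the remaining product is then the value at [x] of the derivative of
   [X^n - 1]. *)
Lemma sum_ln_dist_unity_roots (n : nat) (rs : seq K) (x : K) :
  (0 < n)%N -> uniq rs -> 'X^n - 1 = \prod_(z <- rs) ('X - z%:P) ->
  \sum_(z <- rs) ln (abs (x - z)) =
    ln (abs (if x ^+ n == 1 then n%:R * x ^+ n.-1 else x ^+ n - 1)).
Proof.
move=> n_gt0 rs_uniq Drs.
have prod_dist (s : seq K) : x \notin s ->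
    ln (abs (\prod_(z <- s) (x - z))) = \sum_(z <- s) ln (abs (x - z)).
  move=> xs; rewrite (abs_prod absP) ln_prod // => z zs.
  by rewrite (abs_gt0 absP) subr_eq0; apply: contraNneq xs => ->.
have Dx : (x ^+ n == 1) = (x \in rs).
  by rewrite -root_prod_XsubC -Drs /root !hornerE subr_eq0.
have horner_prodX (s : seq K) :
    (\prod_(z <- s) ('X - z%:P)).[x] = \prod_(z <- s) (x - z).
  by rewrite horner_prod; apply: eq_bigr => z _; rewrite hornerXsubC.
rewrite Dx; case: ifPn => [xrs|xrs]; last first.
  by rewrite -prod_dist // -horner_prodX -Drs !hornerE.
have Prs := perm_to_rem xrs.
rewrite (perm_big _ Prs) big_cons /= subrr (abs0 absP) (ln0 (lexx 0)) add0r.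
rewrite -prod_dist ?(mem_rem_uniq _ rs_uniq) ?inE ?eqxx // -horner_prodX.
congr (ln (abs _)).
have := congr1 (fun q : {poly K} => (deriv q).[x]) Drs.
rewrite (perm_big _ Prs) big_cons /= derivM derivXsubC derivB derivXn /= !hornerE.
by rewrite -polyC1 derivC horner0 !subr0 subrr mul0r addr0 hornerMn hornerXn mulr_natl => <-.
Qed.

End UnityRoots.

Section CpUnityRoots.
Variables (R : realType) (p : nat) (K : fieldType) (abs : K -> R).
Hypothesis p_prime : prime p.
Hypothesis K_Cp : is_Cp p abs.

Let absP := Cp_nonarch_abs K_Cp.

Lemma Cp_unity_dist_lower_bound (x : K) : abs x = 1 ->
  exists2 C : R, 0 < C & forall n, (0 < n)%N ->
    n%:R^-1 * C <= abs (if x ^+ n == 1 then n%:R * x ^+ n.-1 else x ^+ n - 1).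
Proof.
move=> x1; have abs_coprime := Cp_abs_coprime K_Cp.
have abs_p := Cp_abs_prime p_prime K_Cp.
have [C C_gt0 hC] := abs_expr_sub1_lower_bound absP p_prime abs_p abs_coprime x1.
(* [C] covers the case [x ^+ n != 1]; 1 covers the derivative, where |n x^(n-1)| = |n| >= 1/n. *)
exists (Num.min C 1); first by rewrite lt_min C_gt0 ltr01.
move=> n n_gt0; have n_inv_ge0 : 0 <= n%:R^-1 :> R by rewrite invr_ge0.
case: ifPn => [_|xn]; last first.
  by apply: le_trans (hC n n_gt0 xn); rewrite ler_wpM2l // ge_min lexx.
rewrite (nonarch_absM absP) (absX absP) x1 expr1n mulr1.
apply: le_trans (abs_nat_ge absP p_prime abs_p abs_coprime n_gt0).
by rewrite ler_piMr // ge_min lexx orbT.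
Qed.

(** By [sum_ln_dist_unity_roots] this sequence is the mean of log |x - z| over the n-th roots of
    unity z. In x^n - 1 the term 1 dominates if |x| < 1 and the term x^n if |x| > 1; on the unit
    circle a squeeze is needed. *)
Lemma Cp_unity_dist_cvg (x : K) :
  n%:R^-1 * ln (abs (if x ^+ n == 1 then n%:R * x ^+ n.-1 else x ^+ n - 1))
    @[n --> \oo] --> ln (Num.max 1 (abs x)).
Proof.
have absx_ge0 := nonarch_abs_ge0 absP x.
have not_unity n : (0 < n)%N -> abs x != 1 -> x ^+ n != 1.
  move=> n_gt0; apply: contra_neq => xn1; apply/eqP.
  by rewrite -(@eqrXn2 _ n) ?ler01 // -(absX absP) xn1 (abs1 absP) expr1n.
case: (ltgtP (abs x) 1) => [x_lt1|x_gt1|x1].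
- apply: cvg_near_cst; near=> n.
  have n_gt0 : (0 < n)%N by near: n; exact: nbhs_infty_gt.
  rewrite (negPf (not_unity n n_gt0 _)) ?lt_eqF // (abs_subC absP).
  rewrite [abs _](_ : _ = 1) ?ln1 ?mulr0 //.
  rewrite -(abs1 absP); apply: (abs_eq_of_close absP).
  rewrite addrAC subrr add0r (absN absP) (absX absP) (abs1 absP).
  by rewrite exprn_ilt1 // gt_eqF.
- apply: cvg_near_cst; near=> n.
  have n_gt0 : (0 < n)%N by near: n; exact: nbhs_infty_gt.
  rewrite (negPf (not_unity n n_gt0 _)) ?gt_eqF //.
  rewrite [abs _](_ : _ = abs (x ^+ n)).
    rewrite (absX absP) lnXn ?(lt_trans _ x_gt1) // -[ln _ *+ n]mulr_natl mulKf //.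
    by rewrite pnatr_eq0 gt_eqF.
  apply: (abs_eq_of_close absP).
  rewrite addrAC subrr add0r (absN absP) (absX absP) (abs1 absP).
  by rewrite exprn_egt1 // gt_eqF.
- rewrite ?x1 ?maxxx ln1.
  have [C C_gt0 hC] := Cp_unity_dist_lower_bound x1.
  have lower_cvg : n%:R^-1 * ln C - n%:R^-1 * ln n%:R @[n --> \oo] --> (0 : R).
    rewrite -[X in _ --> X]subr0; apply: cvgB; last exact: invn_ln_cvg0.
    rewrite -[X in _ --> X](mul0r (ln C)).
    by apply: cvgM; [exact: invn_cvg0 | exact: cvg_cst].
  apply: squeeze_cvgr lower_cvg (cvg_cst 0); near=> n.
  have n_gt0 : (0 < n)%N by near: n; exact: nbhs_infty_gt.
  have Rn_gt0 : 0 < n%:R :> R by rewrite ltr0n.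
  have n_inv_gt0 : 0 < n%:R^-1 :> R by rewrite invr_gt0.
  have nC := hC n n_gt0.
  have nC_gt0 : 0 < n%:R^-1 * C by rewrite mulr_gt0.
  rewrite -mulrBr ler_pM2l // -ln_div ?posrE // [C / _]mulrC.
  rewrite ler_ln ?posrE ?(lt_le_trans nC_gt0) // nC /=.
  rewrite pmulr_rle0 // ln_le0 //; case: ifP => _.
    rewrite (nonarch_absM absP) (absX absP) x1 expr1n mulr1.
    exact: abs_nat_le1.
  by apply: (abs_sub_le absP); rewrite ?(absX absP) ?x1 ?expr1n ?(abs1 absP).
Unshelve. all: by end_near. Qed.

End CpUnityRoots.

(** * Evaluating Laurent polynomials and rewriting the Mahler sum *)

Lemma laurent_eval_shift (K : fieldType) (f : laurent K) (m : int)
    (q : {poly K}) (z : K) :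
  eq_laurent_shift f m q -> z != 0 -> laurent_eval f z = z ^ m * q.[z].
Proof.
move=> fq z_neq0.
have fE (i : nat) : f (m + i%:Z) = q`_i by rewrite fq addrAC subrr add0r.
have supp_perm : perm_eq (finsupp f)
    [seq k <- [seq m + i%:Z | i <- index_iota 0 (size q)] | f k != 0].
  apply: uniq_perm; rewrite ?fset_uniq // ?filter_uniq //.
    by rewrite map_inj_uniq ?iota_uniq // => i j /addrI [].
  move=> k; rewrite mem_finsupp mem_filter; case: eqVneq => //= fk.
  apply/esym/mapP; case: (k - m) (subrK m k) (fq k) fk => [i|i] <- ->; last by rewrite eqxx.
  move=> qi; exists i; last by rewrite addrC.
  by rewrite mem_index_iota /= ltnNge; apply: contraNN qi => /(nth_default 0) ->.
rewrite /laurent_eval (perm_big _ supp_perm) big_filter big_mkcond /=.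
rewrite big_map horner_coef big_mkord mulr_sumr.
apply: eq_bigr => i _; rewrite fE expfzDr // mulrCA -exprnP.
by case: eqVneq => // ->; rewrite mul0r mulr0.
Qed.

Lemma log_mahler_seqE (R : realType) (K : fieldType) (abs : K -> R)
    (f : laurent K) (n : nat) (rs : seq K) :
  uniq rs -> 'X^n - 1 = \prod_(z <- rs) ('X - z%:P) ->
  log_mahler_seq abs f n =
    n%:R^-1 * \sum_(z <- rs | laurent_eval f z != 0) ln (abs (laurent_eval f z)).
Proof.
move=> rs_uniq Drs; rewrite /log_mahler_seq -[in RHS]big_filter.
set s := [seq z <- rs | _].
suff -> : [set z | z ^+ n = 1 /\ laurent_eval f z != 0] = [set` s].
  by rewrite -fsbig_seq ?filter_uniq.
apply/seteqP; split=> z /=; rewrite mem_filter -root_prod_XsubC -Drs /root !hornerE;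
  rewrite subr_eq0.
  by case=> -> ->; rewrite eqxx.
by case/andP=> fz /eqP zn.
Qed.

(** * Convergence of the Mahler means and the two closed forms *)

Theorem theorem2p5 (R : realType) (p : nat) (p_prime : prime p)
    (Cp : fieldType) (abs : Cp -> R) (Cp_abs : is_Cp p abs)
    (f : laurent Cp) (f_neq0 : exists k : int, f k != 0)
    (d : int) (l : nat) (a : 'I_l.+1 -> Cp) (alpha : 'I_l -> Cp)
    (f_coef : forall k : int,
       f k = \sum_(i < l.+1 | k == d - (i : nat)%:Z) a i)
    (f_fact : eq_laurent_shift f (d - l%:Z)
                (a ord0 *: \prod_(i < l) ('X - (alpha i)%:P)))
    (a0al_neq0 : a ord0 * a ord_max != 0) :
  [/\ cvg (log_mahler_seq abs f n @[n --> \oo]),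
      ln (mahler abs f) =
        ln (abs (a ord_max))
        - \sum_(i < l | 0 < abs (alpha i) < 1) ln (abs (alpha i))
    & ln (mahler abs f) =
        ln (abs (a ord0)) + \sum_(i < l | 1 < abs (alpha i)) ln (abs (alpha i))].
Proof.
have absP := Cp_nonarch_abs Cp_abs.
have [a0_neq0 al_neq0] : a ord0 != 0 /\ a ord_max != 0.
  by apply/andP; rewrite -negb_or -mulf_eq0.
(* The coefficient of t^(d-l) is read off from both descriptions of [f]. *)
have Dal : a ord_max = a ord0 * \prod_(i < l) - alpha i.
  transitivity (f (d - l%:Z)).
    rewrite f_coef (big_pred1 ord_max) // => i /=.
    rewrite (inj_eq (addrI d)) eqr_opp eq_sym; exact: (inj_eq val_inj i ord_max).
  rewrite f_fact subrr /= -horner_coef0 hornerZ horner_prod; congr (_ * _).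
  by apply: eq_bigr => i _; rewrite hornerXsubC sub0r.
have alpha_neq0 i : alpha i != 0.
  move: al_neq0; rewrite Dal mulf_eq0 negb_or => /andP[_ /prodf_neq0/(_ i isT)].
  by rewrite oppr_eq0.
have ln_al : ln (abs (a ord_max)) =
    ln (abs (a ord0)) + \sum_(i < l) ln (abs (alpha i)).
  rewrite Dal (nonarch_absM absP) (abs_prod absP) lnM ?posrE ?prodr_gt0 //.
  - rewrite ln_prod => [|i _]; last by rewrite (abs_gt0 absP) oppr_eq0.
    by congr (_ + _); apply: eq_bigr => i _; rewrite (absN absP).
  - by rewrite (abs_gt0 absP).
  - by move=> i _; rewrite (abs_gt0 absP) oppr_eq0.
(* On roots of unity the monomial factor has absolute value 1, so [g] is log |f| away from the zeros
   of f. At a zero, [ln 0 = 0] drops the vanishing factors and [g] stays finite. *)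
pose g z := ln (abs (a ord0)) + \sum_(i < l) ln (abs (z - alpha i)).
have fE z : z != 0 -> laurent_eval f z =
    z ^ (d - l%:Z) * (a ord0 * \prod_(i < l) (z - alpha i)).
  move=> z_neq0; rewrite (laurent_eval_shift f_fact) // hornerZ horner_prod.
  by congr (_ * (_ * _)); apply: eq_bigr => i _; rewrite hornerXsubC.
have ln_f z : z != 0 -> abs z = 1 -> laurent_eval f z != 0 ->
    ln (abs (laurent_eval f z)) = g z.
  move=> z_neq0 z1; rewrite fE // !mulf_eq0 !negb_or => /and3P[_ _ /prodf_neq0 zalpha].
  have dist_gt0 i : 0 < abs (z - alpha i) by rewrite (abs_gt0 absP) zalpha.
  have z_unit : abs (z ^ (d - l%:Z)) = 1.
    case: (d - l%:Z) => k; first by rewrite -exprnP (absX absP) z1 expr1n.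
    apply: (@mulIf _ (abs (z ^+ k.+1))); first by rewrite (absX absP) z1 expr1n oner_neq0.
    rewrite -(nonarch_absM absP) NegzE -exprnN mulVf ?expf_neq0 //.
    by rewrite (abs1 absP) (absX absP) z1 expr1n mul1r.
  rewrite !(nonarch_absM absP) z_unit mul1r (abs_prod absP).
  by rewrite lnM ?posrE ?prodr_gt0 ?(abs_gt0 absP) // ln_prod.
pose L := ln (abs (a ord0)) + \sum_(i < l) ln (Num.max 1 (abs (alpha i))).
(* A bound independent of n for the total of [g] over the roots of unity that are zeros of f. *)
pose bad := \sum_(i < l) `|g (alpha i)|.
(* Placing [0 < n] under the existential lets [choice] give one function [rs] on all of [nat],
   unconstrained at 0. *)
have roots_ex n : exists rs : seq Cp, (0 < n)%N ->
    uniq rs /\ 'X^n - 1 = \prod_(z <- rs) ('X - z%:P).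
  have [n_gt0|] := posnP n; first by exists [::]; rewrite n_gt0.
  by case/(Cp_unity_roots p_prime Cp_abs) => rs *; exists rs.
have [rs rsP] := choice roots_ex.
have unity_root n z : (0 < n)%N -> z \in rs n -> z != 0 /\ abs z = 1.
  move=> n_gt0; rewrite -root_prod_XsubC -(rsP n n_gt0).2 /root !hornerE subr_eq0.
  move/eqP=> zn; split.
    by apply: contra_eq_neq zn => ->; rewrite expr0n gt_eqF // eq_sym oner_neq0.
  apply/eqP; rewrite -(@eqrXn2 _ n) ?ler01 ?(nonarch_abs_ge0 absP) //.
  by rewrite -(absX absP) zn (abs1 absP) expr1n.
(* The mean of [g] runs over all n-th roots of unity, zeros of f included; exchanging the sums turns
   it into one mean of log distances for each [alpha i]. *)
have mean_cvg : n%:R^-1 * \sum_(z <- rs n) g z @[n --> \oo] --> L.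
  have limit : ln (abs (a ord0)) + \sum_(i < l) (n%:R^-1 *
      ln (abs (if alpha i ^+ n == 1 then n%:R * alpha i ^+ n.-1
               else alpha i ^+ n - 1))) @[n --> \oo] --> L.
    apply: cvgD; first exact: cvg_cst.
    apply: cvg_big => [|i _]; first exact: add_continuous.
    exact: Cp_unity_dist_cvg p_prime Cp_abs _.
  apply: cvg_trans limit; apply: near_eq_cvg; near=> n.
  have n_gt0 : (0 < n)%N by near: n; exact: nbhs_infty_gt.
  have [rs_uniq Drs] := rsP n n_gt0.
  have size_rs : size (rs n) = n.
    apply: succn_inj; rewrite -(size_prod_XsubC (rs n) id) -Drs.
    by rewrite -[X in _ - X]polyC1 size_XnsubC.
  rewrite /g big_split /= mulrDr; congr (_ + _).
    rewrite big_const_seq count_predT size_rs iter_addr_0 -[ln _ *+ n]mulr_natl mulKf //.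
    by rewrite pnatr_eq0 gt_eqF.
  rewrite exchange_big mulr_sumr; apply: eq_bigr => i _; congr (_ * _).
  rewrite -(sum_ln_dist_unity_roots absP _ n_gt0 rs_uniq Drs).
  by apply: eq_bigr => z _; rewrite (abs_subC absP).
have bad_cvg : n%:R^-1 * \sum_(z <- rs n | laurent_eval f z == 0) g z
    @[n --> \oo] --> (0 : R).
  have bound_cvg (c : R) : n%:R^-1 * c @[n --> \oo] --> (0 : R).
    have -> : 0 = 0 * c by rewrite mul0r.
    by apply: cvgM; [exact: invn_cvg0 | exact: cvg_cst].
  apply: squeeze_cvgr (bound_cvg (- bad)) (bound_cvg bad); near=> n.
  have n_gt0 : (0 < n)%N by near: n; exact: nbhs_infty_gt.
  rewrite !ler_pM2l ?invr_gt0 ?ltr0n // -ler_norml.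
  apply: le_trans (ler_norm_sum _ _ _) _; rewrite -big_filter.
  have -> : bad = \sum_(z <- codom alpha) `|g z| by rewrite big_map big_enum.
  (* The roots of unity are listed without repetition, and those where f vanishes are among the
     [alpha i]. *)
  apply: ler_sum_subset => //; first by rewrite filter_uniq ?(rsP n n_gt0).1.
  move=> z; rewrite mem_filter => /andP[fz0 /unity_root[] // z_neq0 _].
  move: fz0; rewrite fE // !mulf_eq0 expfz_eq0 (negPf z_neq0) andbF (negPf a0_neq0) /=.
  by case/prodf_eq0 => i _; rewrite subr_eq0 => /eqP->; rewrite codom_f.
have seq_cvg : log_mahler_seq abs f n @[n --> \oo] --> L.
  rewrite -[L]subr0; apply: cvg_trans (cvgB mean_cvg bad_cvg).
  apply: near_eq_cvg; near=> n.
  have n_gt0 : (0 < n)%N by near: n; exact: nbhs_infty_gt.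
  have [rs_uniq Drs] := rsP n n_gt0.
  suff -> : log_mahler_seq abs f n = n%:R^-1 * \sum_(z <- rs n) g z
      - n%:R^-1 * \sum_(z <- rs n | laurent_eval f z == 0) g z by [].
  rewrite (log_mahler_seqE _ _ rs_uniq Drs) -mulrBr; congr (_ * _).
  rewrite [X in _ = X - _](bigID (fun z => laurent_eval f z == 0)) /= addrAC subrr add0r.
  rewrite big_seq_cond [RHS]big_seq_cond; apply: eq_bigr => z /andP[zrs fz].
  by have [z_neq0 z1] := unity_root n z n_gt0 zrs; rewrite ln_f.
have ln_mahler : ln (mahler abs f) = L by rewrite /mahler expRK; apply: cvg_lim.
have LE : L = ln (abs (a ord0)) + \sum_(i < l | 1 < abs (alpha i)) ln (abs (alpha i)).
  rewrite /L [in RHS]big_mkcond; congr (_ + _); apply: eq_bigr => i _.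
  by rewrite /Num.max; case: ifP => // _; rewrite ln1.
split; [exact: cvgP seq_cvg | | by rewrite ln_mahler].
(* Removing from the sum in [ln_al] the terms of absolute value below 1 leaves those of absolute
   value at least 1; on the unit circle they are [ln 1 = 0]. The condition [0 < abs (alpha i)]
   always holds by [alpha_neq0]. *)
rewrite ln_mahler LE ln_al -addrA; congr (_ + _).
rewrite [X in _ = X - _](bigID (fun i => 0 < abs (alpha i) < 1)) /=.
rewrite addrAC subrr add0r [LHS]big_mkcond [RHS]big_mkcond.
apply: eq_bigr => i _; rewrite (abs_gt0 absP) alpha_neq0 /=.
by case: (ltgtP (abs (alpha i)) 1) => // ->; rewrite ln1.
Unshelve. all: by end_near. Qed.
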